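(* There exists a family of instances, indexed by the dimension $n$, of the problem $$\min_{x\in\mathbb{R}^n,\,z\in\{0,1\}^n}\ \tfrac12x^\top Qx+c^\top x+\lambda^\top z\quad\text{s.t.}\quad -M_iz_i\le x_i\le M_iz_i,\ i=1,\dots,n,$$ with $Q\succeq0$, $Q_{ii}>0$ and $\lambda_i\ge0$ for all $i$, and with the sparsity graph of $Q$ a path on $n$ nodes, for which the number of feasible integer leaves of the branch-and-bound tree applied to the CORe formulation is exponential in $n$ (that is, at least $a\,\alpha^n$ for some constants $a>0$, $\alpha>1$ and all sufficiently large $n$).
   Context: The sparsity graph of a symmetric $Q\in\mathbb{R}^{n\times n}$ is the undirected graph on $\{1,\dots,n\}$ with edge $(i,j)$, $i\ne j$, iff $Q_{ij}\neq0$; a path graph has edges exactly $(i,i+1)$, $i=1,\dots,n-1$. Let $g_i:=c_i+\sum_{j\ne i}Q_{ij}x_j$ and $\tau_i:=\sqrt{2\lambda_iQ_{ii}}$. The CORe formulation adds to the problem the requirement that, for every $i$, $(x,z)$ lies in one of the three regimes $\mathcal D_{i,\mathrm{CF}}^0=\{z_i=0,\ x_i=0,\ |g_i|\le\tau_i\}$, $\mathcal D_{i,\mathrm{CF}}^+=\{z_i=1,\ Q_{ii}x_i+g_i=0,\ g_i\ge\tau_i\}$, $\mathcal D_{i,\mathrm{CF}}^-=\{z_i=1,\ Q_{ii}x_i+g_i=0,\ g_i\le-\tau_i\}$, where the choice of regime is encoded by binaries $z_i^+,z_i^-$ with $z_i=z_i^++z_i^-\le 1$ ($z_i^+=1$ for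 $\mathcal D_{i,\mathrm{CF}}^+$, $z_i^-=1$ for $\mathcal D_{i,\mathrm{CF}}^-$, both zero for $\mathcal D_{i,\mathrm{CF}}^0$). A feasible integer leaf is a complete regime assignment $k\in\{0,+,-\}^n$ for which there exists $(x,z)$ with $(x,z)\in\mathcal D_{i,\mathrm{CF}}^{k_i}$ and $-M_iz_i\le x_i\le M_iz_i$ for all $i$. *)

(* Defs.v *)
From HB Require Import structures.
From mathcomp Require Import all_boot all_order all_algebra.
From mathcomp Require Import boolp reals.

Set Implicit Arguments.
Unset Strict Implicit.
Unset Printing Implicit Defensive.

Import Order.TTheory GRing.Theory Num.Theory.
Local Open Scope ring_scope.

(* The data of
     min 1/2 x^T Q x + c^T x + lam^T z
     s.t. - M_i z_i <= x_i <= M_i z_i,  x in R^n,  z in {0,1}^n.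
   Vectors are columns, so the i-th entry of v is v i 0. *)
Record miqp (R : realType) (n : nat) := Miqp {
  quad : 'M[R]_n;
  lin : 'cV[R]_n;
  lam : 'cV[R]_n;
  bigM : 'cV[R]_n
}.

Definition objective (R : realType) n (p : miqp R n) (x z : 'cV[R]_n) : R :=
  2^-1 * (x^T *m quad p *m x) 0 0 + ((lin p)^T *m x) 0 0 + ((lam p)^T *m z) 0 0.

Definition miqp_feasible (R : realType) n (p : miqp R n) (x z : 'cV[R]_n)
    : Prop :=
  forall i : 'I_n,
    (z i 0 = 0 \/ z i 0 = 1) /\
    - bigM p i 0 * z i 0 <= x i 0 <= bigM p i 0 * z i 0.

Definition psd (R : realType) n (Q : 'M[R]_n) : Prop :=
  Q^T = Q /\ forall x : 'cV[R]_n, 0 <= (x^T *m Q *m x) 0 0.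

Definition sparsity_graph (R : realType) n (Q : 'M[R]_n) : rel 'I_n :=
  [rel i j | (i != j) && (Q i j != 0)].

Definition path_graph n : rel 'I_n :=
  [rel i j : 'I_n | (j == i.+1 :> nat) || (i == j.+1 :> nat)].

Definition path_instance (R : realType) n (p : miqp R n) : Prop :=
  [/\ psd (quad p),
      forall i, 0 < quad p i i,
      forall i, 0 <= lam p i 0 &
      sparsity_graph (quad p) =2 @path_graph n].

(* The three regimes 0, +, -, i.e. the values (0,0), (1,0), (0,1) of the
   binaries (z_i^+, z_i^-) subject to z_i = z_i^+ + z_i^- <= 1. *)
Inductive regime := RegZero | RegPlus | RegMinus.

Definition regime_enc (r : regime) : option bool :=
  match r with
  | RegZero => None
  | RegPlus => Some true
  | RegMinus => Some false
  end.

Definition regime_dec (o : option bool) : regime :=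
  match o with
  | None => RegZero
  | Some true => RegPlus
  | Some false => RegMinus
  end.

Lemma regime_encK : cancel regime_enc regime_dec.
Proof. by case. Qed.

HB.instance Definition _ := Finite.copy regime (can_type regime_encK).

Definition core_g (R : realType) n (p : miqp R n) (x : 'cV[R]_n) (i : 'I_n)
    : R :=
  lin p i 0 + \sum_(j < n | j != i) quad p i j * x j 0.

Definition core_tau (R : realType) n (p : miqp R n) (i : 'I_n) : R :=
  Num.sqrt (2 * lam p i 0 * quad p i i).

(* (x, z) belongs to D_{i,CF}^r. *)
Definition in_regime (R : realType) n (p : miqp R n) (i : 'I_n) (r : regime)
    (x z : 'cV[R]_n) : Prop :=
  match r with
  | RegZero => [/\ z i 0 = 0, x i 0 = 0 & `|core_g p x i| <= core_tau p i]
  | RegPlus => [/\ z i 0 = 1, quad p i i * x i 0 + core_g p x i = 0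
                 & core_tau p i <= core_g p x i]
  | RegMinus => [/\ z i 0 = 1, quad p i i * x i 0 + core_g p x i = 0
                  & core_g p x i <= - core_tau p i]
  end.

Definition core_feasible_leaf (R : realType) n (p : miqp R n)
    (k : {ffun 'I_n -> regime}) : Prop :=
  exists x z : 'cV[R]_n,
    miqp_feasible p x z /\ forall i, in_regime p i (k i) x z.

Definition core_leaf_count (R : realType) n (p : miqp R n) : nat :=
  #|[set k : {ffun 'I_n -> regime} | `[< core_feasible_leaf p k >]]|.

(* Main.v *)
Require Import Defs.
From mathcomp Require Import all_boot all_order all_algebra.
From mathcomp Require Import boolp reals.
From mathcomp Require Import zify lra.

Set Implicit Arguments.
Unset Strict Implicit.
Unset Printing Implicit Defensive.

Import Order.TTheory GRing.Theory Num.Theory.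
Local Open Scope ring_scope.

(** Take diagonal entries 2, off-diagonal entries 1 on the path, c_i = 3 and
    lambda_i = 1, so that tau_i = 2. A selected node whose neighbours are all
    unselected has g_i = 3 > 2 and sits at x_i = -3/2. Each selected neighbour
    lowers g_i by 3/2, so an unselected node with one or two selected
    neighbours has g_i = 3/2 or 0, which is below the threshold. Hence every
    maximal independent set of the path, put in regime + with its complement in
    regime 0, is a feasible leaf ([maximal_independent_leaf]); no inequality
    between g_i and the threshold is tight, so the leaves do not come from ties
    between regimes.

    A path has exponentially many maximal independent sets. Cut it into
    blocks of three nodes and pick, independently in each block, the first or
    the second node. The picked nodes are pairwise non-adjacent, so they extend
    to a maximal independent set; that set still reveals the picks, because the
    two candidates of a block are adjacent. This gives 2^(n/3) leaves
    ([leaf_count_lower_bound]), and (5/4)^3 < 2. *)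

(** * Maximal independent sets of a path *)

Definition independent n (S : {set 'I_n}) : bool :=
  [forall i in S, forall j in S, ~~ path_graph i j].

Lemma independentP n (S : {set 'I_n}) :
  reflect {in S &, forall i j, ~~ path_graph i j} (independent S).
Proof.
apply: (iffP 'forall_in_forall_inP) => [h i j iS jS|h i iS j jS];
  exact: h.
Qed.

Lemma path_graph_sym n : symmetric (@path_graph n).
Proof. by move=> i j; rewrite /path_graph /= orbC. Qed.

Lemma path_graph_irr n : irreflexive (@path_graph n).
Proof. by move=> i; rewrite /path_graph /=; lia. Qed.

(** Otherwise [i] could be added to [S]. *)
Lemma maximal_independent_dominating n (S : {set 'I_n}) (i : 'I_n) :
  maxset (@independent n) S -> i \notin S ->
  exists2 j, j \in S & path_graph i j.
Proof.
move=> /maxsetP[/independentP indS maxS] iNS.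
have [/exists_inP[j jS ij]|/exists_inPn noN] :=
  boolP [exists j in S, path_graph i j]; first by exists j.
suff indU : independent (i |: S).
  by move: iNS; rewrite -(maxS _ indU (subsetUr _ _)) setU11.
apply/independentP => a b /setU1P[->|aS] /setU1P[->|bS].
- by rewrite path_graph_irr.
- exact: noN.
- by rewrite path_graph_sym noN.
- exact: indS.
Qed.

Lemma path_degree_le2 n (S : {set 'I_n}) (i : 'I_n) :
  (#|[set j in S | path_graph i j]| <= 2)%N.
Proof.
rewrite cardE -(size_map val).
apply: (@leq_trans (size [:: i.-1; i.+1])) => //; apply: uniq_leq_size.
  by rewrite map_inj_uniq ?enum_uniq//; exact: val_inj.
move=> _ /mapP[j + ->]; rewrite mem_enum !inE /path_graph /= => /andP[_]; lia.
Qed.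

Definition block_pick n (b : {ffun 'I_(n %/ 3) -> bool}) : {set 'I_n} :=
  [set i : 'I_n | [exists k : 'I_(n %/ 3), i == (3 * k + b k)%N :> nat]].

Lemma block_pick_independent n (b : {ffun 'I_(n %/ 3) -> bool}) :
  independent (block_pick b).
Proof.
apply/independentP => i j; rewrite !inE => /existsP[k /eqP ik] /existsP[l /eqP jl].
rewrite /path_graph /= ik jl.
have [<-|kl] := eqVneq k l; first by lia.
have {kl} : (k != l :> nat) by [].
case: (b k); case: (b l) => /=; lia.
Qed.

Lemma block_pick_compatible n (b b' : {ffun 'I_(n %/ 3) -> bool})
    (S : {set 'I_n}) :
  independent S -> block_pick b \subset S -> block_pick b' \subset S -> b = b'.
Proof.
move=> /independentP indS /subsetP bS /subsetP b'S; apply/ffunP => k.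
have lt_n (c : bool) : (3 * k + c < n)%N.
  by have := ltn_ord k; case: c; lia.
have pickP (c : {ffun 'I_(n %/ 3) -> bool}) : Ordinal (lt_n (c k)) \in block_pick c.
  by rewrite inE; apply/existsP; exists k.
have := indS _ _ (bS _ (pickP b)) (b'S _ (pickP b')).
by rewrite /path_graph /=; case: (b k); case: (b' k) => //=; lia.
Qed.

Lemma maximal_independent_count n :
  (2 ^ (n %/ 3) <= #|[set S | maxset (@independent n) S]|)%N.
Proof.
have ext (b : {ffun 'I_(n %/ 3) -> bool}) :=
  maxset_exists (block_pick_independent b).
pose extend b := s2val (ext b).
have max_extend b : maxset (@independent n) (extend b) by exact: s2valP (ext b).
have sub_extend b : block_pick b \subset extend b by exact: s2valP' (ext b).
have -> : (2 ^ (n %/ 3) = #|[set: {ffun 'I_(n %/ 3) -> bool}]|)%N.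
  by rewrite cardsT card_ffun card_bool card_ord.
rewrite -(@card_imset _ _ extend) => [|b b' ebb'].
  apply/subset_leq_card/subsetP => _ /imsetP[b _ ->].
  by rewrite inE.
have /maxsetP[indS _] := max_extend b.
apply: (block_pick_compatible indS (sub_extend b)).
by rewrite ebb'.
Qed.

(** * The instances *)

Section Instance.
Variables (R : realType) (n : nat).

Definition path_quad : 'M[R]_n :=
  \matrix_(i, j) (2 *+ (i == j) + (path_graph i j)%:R).

Definition path_miqp : miqp R n :=
  Miqp path_quad (const_mx 3) (const_mx 1) (const_mx (3 / 2)).

(** Row [e] of this matrix is the edge joining the nodes [e - 1] and [e], with
    a dangling half-edge at either end of the path, which makes every column
    contain exactly two ones. *)
Definition path_incidence : 'M[R]_(n.+1, n) :=
  \matrix_(e, i) ((e == i :> nat) || (e == i.+1 :> nat))%:R.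

Lemma path_quad_factor : path_quad = path_incidence^T *m path_incidence.
Proof.
apply/matrixP => i j; rewrite !mxE.
have lt_i : (i < n.+1)%N by exact: ltnW (ltn_ord i).
have lt_i1 : (i.+1 < n.+1)%N by rewrite ltnS ltn_ord.
rewrite (bigD1 (Ordinal lt_i)) //= (bigD1 (Ordinal lt_i1)) /=; last first.
  by rewrite -val_eqE /=; lia.
rewrite big1 => [|e]; last first.
  rewrite -!val_eqE /= !mxE => /andP[/negPf-> /negPf->].
  by rewrite mul0r.
rewrite !mxE /= !eqxx orbT /= !mul1r addr0 -mulr_natr -!natrM -!natrD -val_eqE /=.
by rewrite /path_graph /=; congr (_%:R); lia.
Qed.

Lemma path_quad_psd : psd path_quad.
Proof.
rewrite path_quad_factor; split=> [|x]; first by rewrite trmx_mul trmxK.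
rewrite mulmxA -trmx_mul -mulmxA mxE; apply: sumr_ge0 => e _.
by rewrite mxE -expr2 sqr_ge0.
Qed.

Lemma path_quad_diag i : path_quad i i = 2.
Proof. by rewrite mxE eqxx path_graph_irr addr0. Qed.

Lemma path_quad_offdiag i j : i != j -> path_quad i j = (path_graph i j)%:R.
Proof. by move=> /negPf ij; rewrite mxE ij add0r. Qed.

Lemma path_miqp_instance : path_instance path_miqp.
Proof.
split => [|i|i|i j] /=.
- exact: path_quad_psd.
- by rewrite path_quad_diag.
- by rewrite mxE.
- rewrite /sparsity_graph /=; have [<-|ij] := eqVneq i j.
    by have /= -> := path_graph_irr i.
  by rewrite path_quad_offdiag //= pnatr_eq0 eqb0 negbK.
Qed.

Lemma path_miqp_tau i : core_tau path_miqp i = 2.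
Proof.
rewrite /core_tau /= path_quad_diag mxE mulr1 -expr2 sqrtr_sqr.
by rewrite ger0_norm.
Qed.

(** * Maximal independent sets are feasible leaves *)

Definition support_leaf (S : {set 'I_n}) : {ffun 'I_n -> regime} :=
  [ffun i => if i \in S then RegPlus else RegZero].

Lemma support_leaf_inj : injective support_leaf.
Proof.
move=> S T /ffunP eST; apply/setP => i; have := eST i.
by rewrite !ffunE; case: (i \in S); case: (i \in T).
Qed.

Definition support_point (S : {set 'I_n}) : 'cV[R]_n :=
  \col_i (- (3 / 2) *+ (i \in S)).

Lemma core_g_support_point (S : {set 'I_n}) i :
  core_g path_miqp (support_point S) i =
  3 - 3 / 2 * #|[set j in S | path_graph i j]|%:R.
Proof.
rewrite /core_g /= mxE; congr (_ + _).
rewrite -mulNr mulr_natr -sumr_const big_mkcond [RHS]big_mkcond /=.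
apply: eq_bigr => j _; rewrite !inE.
have [->|ji] := eqVneq j i; first by rewrite path_graph_irr andbF.
rewrite path_quad_offdiag 1?eq_sym // mxE /=.
by case: (j \in S); case: (path_graph i j); rewrite ?mul1r ?mul0r ?mulr0.
Qed.

Lemma maximal_independent_leaf (S : {set 'I_n}) :
  maxset (@independent n) S -> core_feasible_leaf path_miqp (support_leaf S).
Proof.
move=> maxS; have /maxsetP[/independentP indS _] := maxS.
exists (support_point S), (\col_i (i \in S)%:R); split => i.
  by rewrite !mxE; case: (i \in S) => /=; split; [right|lra|left|lra].
rewrite ffunE; case: ifPn => iS /=;
  rewrite core_g_support_point path_miqp_tau ?path_quad_diag !mxE.
- have -> : [set j in S | path_graph i j] = set0.
    apply/setP => j; rewrite !inE; apply/andP => -[jS].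
    by apply/negP; exact: indS.
  by rewrite cards0 iS; split => //=; lra.
- rewrite (negPf iS); split => //.
  have [j jS ij] := maximal_independent_dominating maxS iS.
  have : (0 < #|[set j in S | path_graph i j]|)%N.
    by apply/card_gt0P; exists j; rewrite inE jS.
  have := path_degree_le2 S i.
  case: #|_| => [|[|[|//]]] // _ _; rewrite ler_norml; lra.
Qed.

Lemma leaf_count_lower_bound : (2 ^ (n %/ 3) <= core_leaf_count path_miqp)%N.
Proof.
apply: leq_trans (maximal_independent_count n) _.
rewrite -(card_imset _ support_leaf_inj).
apply/subset_leq_card/subsetP => _ /imsetP[S + ->]; rewrite !inE => maxS.
by apply/asboolP; exact: maximal_independent_leaf.
Qed.

End Instance.

(** * Exponential growth *)

Lemma pow_div3_lower_bound (R : realType) n :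
  2^-1 * (5 / 4) ^+ n <= 2 ^+ (n %/ 3) :> R.
Proof.
rewrite {1}(divn_eq n 3) exprD mulnC exprM mulrCA.
(* The remainder is at most 2, and (5/4)^2 < 2 pays for it. *)
rewrite -[leRHS]mulr1; apply: ler_pM.
- by rewrite exprn_ge0 // exprn_ge0 //; lra.
- by rewrite mulr_ge0 ?exprn_ge0 //; lra.
- by apply: lerXn2r; rewrite ?nnegrE ?exprn_ge0 //; lra.
- have := ltn_pmod n (isT : (0 < 3)%N).
  by case: (n %% 3)%N => [|[|[|//]]] _; rewrite ?expr0 ?expr1 ?expr2; lra.
Qed.

Theorem proposition3 (R : realType) :
  exists p : forall n : nat, miqp R n,
    (forall n : nat, path_instance (p n)) /\
    exists a alpha : R,
      [/\ 0 < a, 1 < alpha &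
          exists N : nat, forall n : nat, (N <= n)%N ->
            a * alpha ^+ n <= (core_leaf_count (p n))%:R].
Proof.
exists (path_miqp R); split; first exact: path_miqp_instance.
exists 2^-1, (5 / 4); split; [lra|lra|exists 0%N => n _].
apply: le_trans (pow_div3_lower_bound R n) _.
by rewrite -natrX ler_nat leaf_count_lower_bound.
Qed.
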